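(* Let $r$ be a positive integer and let $\lambda^{(1)}\succ\lambda^{(2)}\succ\dots\succ\lambda^{(r)}$ be a sequence of ordered partitions of $r$. For every $r$-pattern $P\in\mathcal{P}(\lambda^{(1)})\cup\dots\cup\mathcal{P}(\lambda^{(r)})$ let $m_P$ be a positive integer. Then there exists an ordered $r$-uniform hypergraph matching $\mathcal{H}$ with \[|\mathcal{H}|=\prod_{P\in\mathcal{P}(\lambda^{(1)})\cup\dots\cup\mathcal{P}(\lambda^{(r)})} m_P,\] such that any two distinct edges $e,f\in\mathcal{H}$ form an $r$-pattern in $\mathcal{P}(\lambda^{(1)})\cup\dots\cup\mathcal{P}(\lambda^{(r)})$, and for each $P\in\mathcal{P}(\lambda^{(1)})\cup\dots\cup\mathcal{P}(\lambda^{(r)})$ every $P$-clique contained in $\mathcal{H}$ has size at most $m_P$.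
   Context: An $r$-uniform hypergraph matching is a finite collection of pairwise disjoint sets (edges), each of size $r$; an ordered one additionally has a total ordering of its vertex set (the union of the edges). An $r$-pattern is a string in $\{\mathrm{A},\mathrm{B}\}^{2r}$ starting with $\mathrm{A}$ with exactly $r$ letters $\mathrm{A}$ and $r$ letters $\mathrm{B}$. Two distinct edges $e,f$ form the $r$-pattern obtained by listing the vertices of $e\cup f$ in increasing order, writing $\mathrm{A}$ for vertices of the edge containing the smallest vertex and $\mathrm{B}$ for the other. A $P$-clique is a set of edges any two distinct of which form $P$; its size is its number of edges. A block partition of an $r$-pattern is a division into consecutive blocks each reading $\mathrm{A}^k\mathrm{B}^k$ or $\mathrm{B}^k\mathrm{A}^k$ ($k\ge1$); collectable patterns are those having one (it is unique). An ordered partition of $r$ is a sequence $(\lambda_1,\dots,\lambda_s)$ of positive integers summing to $r$. $\lambda\succ\lambda'$ means $\lambda'$ is obtained from $\lambda$ by splitting some summands into consecutive smaller summands (as partitions of $\{1,\dots,r\}$ into intervals, $\lambda'$ refines $\lambda$); in a chain $\lambda^{(1)}\succ\dots\succ\lambda^{(r)}$, $\lambda^{(s)}$ has exactly $s$ parts. For $\lambda=(\lambda_1,\dots,\lambda_s)$, $\mathcal{P}(\lambda)$ is the set of collectable $r$-patterns whose block partition consists of $s$ blocks of lengths $2\lambda_1,\dots,2\lambda_s$ in this order. *)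

(* Defs.v *)
From mathcomp Require Import all_boot all_order.

Set Implicit Arguments.
Unset Strict Implicit.
Unset Printing Implicit Defensive.

Definition letter := bool.
Definition letA : letter := true.
Definition letB : letter := false.

Definition is_pattern (r : nat) (w : seq letter) : bool :=
  [&& ohead w == Some letA, count_mem letA w == r & count_mem letB w == r].

Section Matching.

Context {d : Order.disp_t} {V : finOrderType d}.
Implicit Types (e f : {set V}) (H K : {set {set V}}).

(* The ordering is the one carried by [V], and the last clause makes [V] exactly
   the vertex set of the matching. *)
Definition ordered_matching (r : nat) H : Prop :=
  [/\ trivIset H, forall e, e \in H -> #|e| = r & cover H = [set: V]].

Definition sorted_vertices e f : seq V := sort <=%O (enum (e :|: f)).

(* The edge among [e] and [f] that contains the smallest vertex of [e :|: f]. *)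
Definition first_edge e f : {set V} :=
  if sorted_vertices e f is v :: _ then if v \in e then e else f else e.

Definition pair_word e f : seq letter :=
  [seq if v \in first_edge e f then letA else letB | v <- sorted_vertices e f].

Definition forms (r : nat) e f (P : (2 * r).-tuple letter) : Prop :=
  pair_word e f = P.

Definition is_clique (r : nat) (P : (2 * r).-tuple letter) K : Prop :=
  forall e f, e \in K -> f \in K -> e != f -> forms e f P.

End Matching.

Definition is_block (b : seq letter) : bool :=
  let k := (size b)./2 in
  (0 < k) && ((b == nseq k letA ++ nseq k letB) || (b == nseq k letB ++ nseq k letA)).

Definition block_partition (w : seq letter) (bs : seq (seq letter)) : bool :=
  (flatten bs == w) && all is_block bs.

Definition ordered_partition (r : nat) (lam : seq nat) : bool :=
  (sumn lam == r) && all (ltn 0) lam.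

(* [split_parts lam lam'] is the strict relation "lam is coarser than lam'": the
   i-th entry of [ls] lists the parts into which the i-th summand is split. It is
   only applied to sequences of positive integers, so no entry of [ls] is empty. *)
Definition split_parts (lam lam' : seq nat) : Prop :=
  lam != lam' /\
  exists ls : seq (seq nat), lam = [seq sumn l | l <- ls] /\ lam' = flatten ls.

(* As [split_parts] is strict, [lam s] has exactly [s] parts: see [chain_size]. *)
Definition partition_chain (r : nat) (lam : nat -> seq nat) : Prop :=
  (forall s, 1 <= s <= r -> ordered_partition r (lam s)) /\
  (forall s, 1 <= s < r -> split_parts (lam s) (lam s.+1)).

(* [reshape] cuts [P] into consecutive pieces of the prescribed lengths; see
   [block_patternsP] for the formulation with an arbitrary block partition. *)
Definition block_patterns (r : nat) (lam : seq nat) : {set (2 * r).-tuple letter} :=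
  [set P : (2 * r).-tuple letter |
    let ls := [seq 2 * k | k <- lam] in
    [&& is_pattern r P, block_partition P (reshape ls P)
      & shape (reshape ls P) == ls]].

Lemma block_patternsP (r : nat) (lam : seq nat) (P : (2 * r).-tuple letter) :
  reflect (is_pattern r P /\
           exists2 bs, block_partition P bs & shape bs = [seq 2 * k | k <- lam])
          (P \in block_patterns r lam).
Proof.
rewrite inE; apply: (iffP and3P) => [[-> Pbs /eqP sh]|[-> [bs Pbs sh]]].
  by split=> //; exists (reshape [seq 2 * k | k <- lam] P).
have [/eqP fl _] := andP Pbs.
have rs : reshape [seq 2 * k | k <- lam] P = bs by rewrite -sh -fl flattenK.
by rewrite rs sh.
Qed.

Lemma is_block_nseq (b : seq letter) : is_block b ->
  exists (x : letter) (k : nat), b = nseq k.+1 x ++ nseq k.+1 (~~ x).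
Proof.
rewrite /is_block; case: (_./2) => // k /orP[] /eqP ->.
- by exists letA, k.
- by exists letB, k.
Qed.

Lemma block_partition_uniq (w : seq letter) (bs bs' : seq (seq letter)) :
  block_partition w bs -> block_partition w bs' -> bs = bs'.
Proof.
have run x n k u : find (predC1 x) (nseq n x ++ nseq k.+1 (~~ x) ++ u) = n.
  by elim: n => [|n IHn]; [case: x | rewrite /= eqxx /= IHn].
move=> /andP[/eqP <- allb] /andP[/eqP].
elim: bs bs' allb => [|b bs IH] [|b' bs'] //=.
- by move=> _ E /andP[/is_block_nseq[x [k b'E]] _]; rewrite b'E in E.
- by move=> /andP[/is_block_nseq[x [k ->]] _].
move=> /andP[/is_block_nseq[x [k ->]] allb] E /andP[/is_block_nseq[y [j b'E]] allb'].
rewrite {}b'E -!catA in E *.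
have xy : y = x by case: E.
rewrite {}xy in E *.
have jk : j = k by have := congr1 (find (predC1 x)) E; rewrite !run => -[].
rewrite {}jk in E *.
move/eqP: E; rewrite !eqseq_cat // !eqxx /= => /eqP E.
by rewrite (IH bs').
Qed.

Lemma chain_size (r : nat) (lam : nat -> seq nat) (s : nat) :
  partition_chain r lam -> 1 <= s <= r -> size (lam s) = s.
Proof.
move=> [part split].
have incr t : 1 <= t < r -> size (lam t) < size (lam t.+1).
  move=> tr; have [neq [ls [E E']]] := split _ tr.
  have /andP[t1 tr'] := tr.
  have /andP[_ pos] : ordered_partition r (lam t) by apply: part; rewrite t1 ltnW.
  rewrite {}E {}E' in neq pos *.
  elim: ls neq pos {tr t1 tr'} => //= l ls IH neq /andP[l0 pos].
  rewrite size_map size_cat -ltnS.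
  have le : size ls <= size (flatten ls).
    elim: ls pos {IH neq} => //= m ls IH /andP[m0 /IH ms].
    rewrite size_cat; case: m m0 => //= a m _.
    by rewrite addSn ltnS; apply: leq_trans ms (leq_addl _ _).
  case: l l0 neq => [//|a [|b l]] _ /=.
    rewrite addn0 eqseq_cons eqxx /= => neq.
    by have := IH neq pos; rewrite size_map add1n !ltnS.
  by move=> _; rewrite !addSn !ltnS; apply: leq_trans le (leq_addl _ _).
have lo : forall t, 1 <= t <= r -> t <= size (lam t).
  elim=> [//|[|t] IH] /andP[_ tr].
    have /andP[/eqP sm _] : ordered_partition r (lam 1) by rewrite part.
    by case: (lam 1) sm => // sm; rewrite -sm in tr.
  by apply: leq_ltn_trans (IH _) (incr _ _); rewrite //= ltnW.
have hi : forall n, n < r -> size (lam (r - n)) <= r - n.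
  elim=> [|n IH] nr.
    have /andP[/eqP sm pos] : ordered_partition r (lam r) by rewrite part // leqnn andbT (leq_ltn_trans _ nr).
    rewrite subn0 -[X in _ <= X]sm.
    elim: (lam r) pos => //= a l IHl /andP[a0 /IHl le].
    by rewrite -add1n; apply: leq_add.
  have e : r - n = (r - n.+1).+1 by rewrite subnSK ?(ltnW nr).
  have := incr (r - n.+1); rewrite -e subn_gt0 nr leq_subr => /(_ isT) lt.
  by rewrite -ltnS -e; apply: leq_trans lt (IH (ltnW nr)).
move=> /andP[s1 sr]; apply/eqP; rewrite eqn_leq lo ?s1 // andbT.
have := hi (r - s); rewrite subKn //; apply.
by rewrite ltn_subrL s1 (leq_trans s1 sr).
Qed.

(* Main.v *)
(* The edges are indexed by the functions x assigning to every pattern P a number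
   x P < m P. List the patterns by level, coarse partitions first, and order the
   vertices (x, i) lexicographically by the sequence that records, for each
   pattern P in turn, the index of the block of P containing i and then x P,
   reversed to m P - x P when that block reads B..BA..A. If P is the first pattern
   with x P <> y P, then the earlier entries only compare blocks that are unions of
   blocks of P, so the edges x and y form exactly P. Hence the edges of a P-clique
   have pairwise distinct P-coordinates, and there are at most m P of them. *)
Require Import Defs.
From mathcomp Require Import all_boot all_order.
From mathcomp Require Import zify.

Set Implicit Arguments.
Unset Strict Implicit.
Unset Printing Implicit Defensive.

Import Order.POrderTheory.

(** * Parts of an ordered partition and refinement *)

(* Positions [i >= sumn lam] get the junk value [size lam]. *)
Fixpoint part_index (lam : seq nat) (i : nat) : nat :=
  if lam is k :: lam' then if i < k then 0 else (part_index lam' (i - k)).+1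
  else 0.

Lemma leq_part_index (lam : seq nat) : {homo part_index lam : i j / i <= j}.
Proof.
elim: lam => //= k lam IH i j ij.
case: (ltnP i k) => // ki; rewrite (ltnNge j) (leq_trans ki ij) /= ltnS.
exact/IH/leq_sub2r.
Qed.

Lemma part_index_cat (l lam : seq nat) (i : nat) :
  part_index (l ++ lam) i =
    if i < sumn l then part_index l i else size l + part_index lam (i - sumn l).
Proof.
elim: l i => [|k l IH] i /=; first by rewrite subn0.
rewrite IH subnDA; case: (ltnP i k) => ik.
  by rewrite (leq_trans ik (leq_addr _ _)).
by rewrite ltn_subLR //; case: ifP.
Qed.

Lemma part_index_lt (lam : seq nat) (i : nat) :
  (part_index lam i < size lam) = (i < sumn lam).
Proof.
elim: lam i => //= k lam IH i; case: (ltnP i k) => ik.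
  by rewrite (leq_trans ik (leq_addr _ _)).
by rewrite ltnS IH ltn_subLR.
Qed.

(** Each coarse part is a run of consecutive fine parts, so the coarse index is a monotone function
    of the fine index alone. *)
Lemma part_index_flatten (ls : seq (seq nat)) (i : nat) :
  part_index [seq sumn l | l <- ls] i =
  part_index [seq size l | l <- ls] (part_index (flatten ls) i).
Proof.
elim: ls i => //= l ls IH i; rewrite part_index_cat.
case: (ltnP i (sumn l)) => il; first by rewrite part_index_lt il.
by rewrite ltnNge leq_addr /= addKn IH.
Qed.

Section Chain.

Variables (r : nat) (lam : nat -> seq nat).
Hypothesis chain : partition_chain r lam.

(** Composes the monotone index maps of the refinement steps between the two levels. *)
Lemma chain_coarser (s t i j : nat) : 1 <= s -> s <= t -> t <= r ->
  part_index (lam t) i <= part_index (lam t) j ->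
  part_index (lam s) i <= part_index (lam s) j.
Proof.
move=> s0 /subnKC <-; elim: (t - s) => [|n IH]; first by rewrite addn0.
rewrite addnS => sn le; apply: IH (ltnW sn) _; move: le.
have [|_ [ls [-> ->]]] := chain.2 (s + n); first by rewrite sn ltn_addr.
by rewrite !part_index_flatten; apply: leq_part_index.
Qed.

End Chain.

(** * Block orientations and the vertex order of a pattern *)

(** [os] holds the first letter of each block, [true] being A; missing entries default to A. *)
Fixpoint block_word (lam : seq nat) (os : seq bool) : seq letter :=
  if lam is k :: lam' then
    let o := head true os in nseq k o ++ nseq k (~~ o) ++ block_word lam' (behead os)
  else [::].

Definition orientations (r : nat) (lam : seq nat) (P : (2 * r).-tuple letter) : seq bool :=
  [seq head true b | b <- reshape [seq 2 * k | k <- lam] P].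

Lemma block_word_orientations (r : nat) (lam : seq nat) (P : (2 * r).-tuple letter) :
  P \in block_patterns r lam -> block_word lam (orientations lam P) = P.
Proof.
rewrite inE => /and3P[_ /andP[/eqP fl]] + /eqP sh.
rewrite -[RHS]fl /orientations; move: sh.
move: (reshape _ P) => bs; elim: bs lam {fl} => [|b bs IH] [|k lam] //= [sb sh] /andP[bb abs].
rewrite IH // catA; congr (_ ++ _).
have [x [n E]] := is_block_nseq bb; rewrite {}E in sb *.
rewrite size_cat !size_nseq addnn -mul2n in sb.
by have /eqP := sb; rewrite eqn_mul2l /= => /eqP <-.
Qed.

(** Serves to place the smallest vertex in the edge labelled [true]. *)
Lemma head_orientations (r : nat) (lam : seq nat) (P : (2 * r).-tuple letter) :
  P \in block_patterns r lam -> ordered_partition r lam -> head true (orientations lam P).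
Proof.
move=> PP /andP[_ pos]; have := block_word_orientations PP.
move: PP; rewrite inE => /and3P[/and3P[hd _ _] _ _].
case: lam pos => [|k lam] //= /andP[k0 _]; case: k k0 => //= k _ E.
by move: hd; rewrite -E /=; case: head.
Qed.

(* [(true, i)] and [(false, i)] stand for the [i]-th vertices of the edges
   labelled A and B. *)
Fixpoint block_vertices (lam : seq nat) (os : seq bool) : seq (bool * nat) :=
  if lam is k :: lam' then
    let o := head true os in
    [seq (o, i) | i <- iota 0 k] ++ [seq (~~ o, i) | i <- iota 0 k]
      ++ [seq (u.1, k + u.2) | u <- block_vertices lam' (behead os)]
  else [::].

(** The vertex order of two edges forming the pattern, phrased through block indices so that it can
    be matched with lexicographic keys. *)
Definition before (lam : seq nat) (os : seq bool) (u v : bool * nat) : bool :=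
  if u.1 == v.1 then u.2 < v.2 else
    (part_index lam u.2 < part_index lam v.2)
    || (part_index lam u.2 == part_index lam v.2)
       && (u.1 == nth true os (part_index lam u.2)).

Lemma before_total (lam : seq nat) (os : seq bool) (u v : bool * nat) :
  u != v -> before lam os u v || before lam os v u.
Proof.
case: u v => [p i] [q j] /=; rewrite /before /= xpair_eqE (eq_sym q).
case: eqP => [_|pq] /=; first by rewrite neq_ltn.
move=> _; case: ltngtP => //= ->.
by case: p q pq => [] [] // _; case: (nth true os _).
Qed.

Lemma map_fst_block_vertices (lam : seq nat) (os : seq bool) :
  [seq u.1 | u <- block_vertices lam os] = block_word lam os.
Proof.
elim: lam os => //= k lam IH os; rewrite !map_cat -!map_comp -IH /=.
have cst (o : bool) : [seq o | _ <- iota 0 k] = nseq k o.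
  by elim: k 0 {IH} => //= k IHk n; rewrite IHk.
by congr (_ ++ (_ ++ _)); rewrite ?cst.
Qed.

Lemma mem_block_vertices (lam : seq nat) (os : seq bool) (p : bool) (i : nat) :
  ((p, i) \in block_vertices lam os) = (i < sumn lam).
Proof.
elim: lam os p i => //= k lam IH os p i; rewrite !mem_cat.
have memo (o : bool) : ((p, i) \in [seq (o, i) | i <- iota 0 k]) = (p == o) && (i < k).
  apply/mapP/andP => [[j + [-> ->]]|[/eqP -> ik]]; first by rewrite mem_iota add0n.
  by exists i; rewrite ?mem_iota.
have -> : ((p, i) \in [seq (u.1, k + u.2) | u <- block_vertices lam (behead os)])
          = (k <= i < k + sumn lam).
  apply/mapP/andP => [[[q j] + [_ ->]]|[ki ik]].
    by rewrite IH /= leq_addr ltn_add2l.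
  by exists (p, i - k); rewrite ?IH /= ?subnKC // ltn_subLR.
rewrite !memo; case: (p) (head true os) => [] [] /=; lia.
Qed.

Lemma pairwise_block_vertices (lam : seq nat) (os : seq bool) :
  pairwise (before lam os) (block_vertices lam os).
Proof.
elim: lam os => //= k lam IH os; rewrite !pairwise_cat !pairwise_map.
set o := head true os.
have nth0' : nth true os 0 = o by rewrite nth0.
have iotaP (q : bool) : pairwise (relpre (pair q) (before (k :: lam) os)) (iota 0 k).
  have := iota_ltn_sorted 0 k; rewrite (sorted_pairwise ltn_trans).
  by apply: sub_pairwise => i j; rewrite /= /before /= eqxx.
have shiftP (q : bool) : allrel (before (k :: lam) os) [seq (q, i) | i <- iota 0 k]
    [seq (u.1, k + u.2) | u <- block_vertices lam (behead os)].
  rewrite allrel_mapl allrel_mapr; apply/allrelP => i [p j].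
  rewrite mem_iota /= add0n /before /= => ik _.
  by rewrite ik (ltnNge (k + j)) leq_addr /=; case: eqP => // _; apply: ltn_addr.
rewrite allrel_catr !shiftP !iotaP /= andbT; apply/andP; split.
  rewrite allrel_mapl allrel_mapr; apply/allrelP => i j; rewrite !mem_iota !add0n /=.
  by move=> ik jk; rewrite /before /= ik jk /= nth0' eqxx; case: (o).
(* Prepending a block shifts positions by [k] and block indices by one, which leaves [before]
   unchanged. *)
move: (IH (behead os)); apply: sub_pairwise => -[p i] [q j].
by rewrite /before /= !(ltnNge _ k) !leq_addr /= !addKn ltn_add2l eqSS ltnS nth_behead.
Qed.

(** * The pattern formed by two edges *)

Section PairWord.

Variables (d : Order.disp_t) (V : finOrderType d) (r : nat).
Variables (lam : seq nat) (os : seq bool) (c : bool -> nat -> V).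
Hypothesis lam_sum : sumn lam = r.+1.
Hypothesis lam_pos : all (ltn 0) lam.
Hypothesis os_head : head true os.
Hypothesis c_before : forall u v : bool * nat, u.2 <= r -> v.2 <= r ->
  before lam os u v -> (c u.1 u.2 < c v.1 v.2)%O.

Let edge (p : bool) : {set V} := [set c p i | i : 'I_r.+1].
Let vert (u : bool * nat) : V := c u.1 u.2.

Lemma vert_inj (p q : bool) (i j : nat) : i <= r -> j <= r ->
  c p i = c q j -> (p, i) = (q, j).
Proof.
move=> ir jr E; apply/eqP/negPn/negP => /(before_total lam os)/orP[] /c_before /=.
  by move=> /(_ ir jr); rewrite E ltxx.
by move=> /(_ jr ir); rewrite E ltxx.
Qed.

Lemma mem_edge (p q : bool) (i : nat) : i <= r -> (c p i \in edge q) = (p == q).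
Proof.
move=> ir; apply/imsetP/eqP => [[j _ /vert_inj]|->].
  by case/(_ ir (ltn_ord j)).
by exists (Ordinal (ir : i < r.+1)).
Qed.

(** Two strictly increasing sequences with the same members are equal. *)
Lemma sorted_verticesE :
  sorted_vertices (edge true) (edge false) = [seq vert u | u <- block_vertices lam os].
Proof.
apply: lt_sorted_eq; first by rewrite Order.TotalTheory.sort_lt_sorted enum_uniq.
  rewrite lt_sorted_pairwise pairwise_map.
  have:= pairwise_block_vertices lam os; apply: (sub_in_pairwise (P := [pred u | u.2 <= r])).
    by move=> u v ur vr; apply: c_before.
  by apply/allP => -[p i]; rewrite mem_block_vertices lam_sum.
move=> v; rewrite mem_sort mem_enum inE; apply/orP/mapP.
  by case=> /imsetP[i _ ->]; [exists (true, val i)|exists (false, val i)];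
    rewrite ?mem_block_vertices ?lam_sum ?ltn_ord.
case=> -[p i]; rewrite mem_block_vertices lam_sum ltnS => ir ->.
by rewrite /vert !mem_edge //; case: p; [left|right].
Qed.

(** [os_head] puts the smallest vertex in [edge true], which therefore receives A in either order of
    the arguments. *)
Lemma pair_word_edges :
  pair_word (edge true) (edge false) = block_word lam os /\
  pair_word (edge false) (edge true) = block_word lam os.
Proof.
have hd : exists bv, block_vertices lam os = (true, 0) :: bv.
  case: lam lam_sum lam_pos => //= k l _ /andP[k0 _].
  by case: k k0 => // k _ /=; case: (head true os) os_head => // _; eexists.
have [bv bvE] := hd.
have svC : sorted_vertices (edge false) (edge true) = sorted_vertices (edge true) (edge false).
  by rewrite /sorted_vertices setUC.
have fe : first_edge (edge true) (edge false) = edge true.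
  by rewrite /first_edge sorted_verticesE bvE /= mem_edge.
have fe' : first_edge (edge false) (edge true) = edge true.
  by rewrite /first_edge svC sorted_verticesE bvE /= mem_edge.
rewrite /pair_word svC fe fe' sorted_verticesE -map_fst_block_vertices -map_comp.
by split; apply/eq_in_map => -[p i]; rewrite mem_block_vertices lam_sum ltnS /= => ir;
  rewrite mem_edge //; case: p.
Qed.

End PairWord.

(** * Ranks and lexicographic keys *)

(* Ranking by the number of predecessors turns any strict order into the order
   of an ordinal. *)
Lemma rank_ordinal (W : finType) (lt : rel W) : irreflexive lt -> transitive lt ->
  exists v : W -> 'I_#|W|, {homo v : u w / lt u w >-> (u < w)%O}.
Proof.
move=> irr tr.
have cardlt w : #|[set u | lt u w]| < #|W|.
  rewrite -cardsT; apply: proper_card; rewrite properT.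
  by apply/eqP => /setP/(_ w); rewrite !inE irr.
exists (fun w => Ordinal (cardlt w)) => u w uw; rewrite ltEord /=.
apply: proper_card; apply/properP; split.
  by apply/subsetP => z; rewrite !inE => zu; apply: tr uw.
by exists u; rewrite inE // irr.
Qed.

Section LexKey.

Variables (I : eqType) (X : Type) (B : I -> nat -> nat) (S : I -> nat -> X -> nat).

(** [S] also receives the block index, since the sign of a coordinate depends on the block. The
    final entry [i] separates the vertices of one edge. *)
Definition lex_key (ps : seq I) (x : X) (i : nat) : seqlexi nat :=
  flatten [seq [:: B p i; S p (B p i) x] | p <- ps] ++ [:: i].

(** Before the entries of [p], a strict block index settles the comparison in the right direction,
    and a tie puts both positions in the same block, where the coordinates agree. *)
Lemma lex_key_lt (ps1 ps2 : seq I) (p : I) (x y : X) (i j : nat) :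
  {in ps1, forall q, B p i <= B p j -> B q i <= B q j} ->
  {in ps1, forall q t, S q t x = S q t y} ->
  (B p i < B p j) || (B p i == B p j) && (S p (B p i) x < S p (B p i) y) ->
  (lex_key (ps1 ++ p :: ps2) x i < lex_key (ps1 ++ p :: ps2) y j)%O.
Proof.
move=> mono same lt.
have le : B p i <= B p j by case/orP: lt => [/ltnW//|/andP[/eqP ->]].
elim: ps1 mono same => [|q ps1 IH] mono same; rewrite /lex_key /= !ltxi_cons !leEnat.
  case/orP: lt => [lt|/andP[/eqP <- lt]]; first by rewrite ltnW // leqNgt lt.
  by rewrite leqnn /= ltnW // leqNgt lt.
rewrite mono ?mem_head //=; apply/implyP => ge.
have <- : B q i = B q j by apply/eqP; rewrite eqn_leq ge mono ?mem_head.
rewrite same ?mem_head // leqnn /=.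
by apply: IH => q' q'in; [apply: mono|apply: same]; rewrite inE q'in orbT.
Qed.

Lemma lex_key_lt_index (ps : seq I) (x : X) (i j : nat) :
  (forall q, {homo B q : i j / i <= j}) ->
  i < j -> (lex_key ps x i < lex_key ps x j)%O.
Proof.
move=> mono ij; elim: ps => [|q ps IH]; rewrite /lex_key /= !ltxi_cons !leEnat.
  by rewrite ltnW // leqNgt ij.
rewrite mono ?(ltnW ij) //=; apply/implyP => ge.
have <- : B q i = B q j by apply/eqP; rewrite eqn_leq ge mono // ltnW.
by rewrite leqnn.
Qed.

End LexKey.

Lemma has_split (T : Type) (p : pred T) (s : seq T) : has p s ->
  exists s1 u s2, [/\ s = s1 ++ u :: s2, p u & ~~ has p s1].
Proof.
by case/split_find => u s1 s2 pu ns1; exists s1, u, s2; split; rewrite ?cat_rcons.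
Qed.

(** * Addresses, levels and vertex keys *)

Section Construction.

Variables (n : nat) (lam : nat -> seq nat).
Let word := (2 * n.+1).-tuple letter.
Variable m : word -> nat.
Hypothesis chain : partition_chain n.+1 lam.

Definition chain_patterns : {set word} := \bigcup_(1 <= s < n.+2) block_patterns n.+1 (lam s).

Lemma chain_patternsP (P : word) :
  reflect (exists2 s, 1 <= s <= n.+1 & P \in block_patterns n.+1 (lam s)) (P \in chain_patterns).
Proof.
rewrite /chain_patterns big_geq_mkord; apply: (iffP bigcupP) => [[s s1 Ps]|[s /andP[s1 sr] Ps]].
  by exists s => //; rewrite (s1 : 0 < s) -ltnS ltn_ord.
by exists (Ordinal (sr : s < n.+2)).
Qed.

(** The value 1 outside the chain forces the coordinate there to be 0, so addresses can be functions
    on all words without changing their number. *)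
Definition multiplicity (P : word) : nat := if P \in chain_patterns then m P else 1.

Definition address : finType := {dffun forall P : word, 'I_(multiplicity P)}.

Lemma card_address : #|address| = \prod_(P in chain_patterns) m P.
Proof.
rewrite card_dep_ffun foldrE big_map [RHS]big_mkcond big_enum /=.
by apply: eq_bigr => P _; rewrite card_ord.
Qed.

Let level := ('I_n.+2 * word)%type.

(** The sort puts coarse partitions first. Index 0 of ['I_n.+2] is excluded, leaving 1 to [n.+1]. *)
Definition levels : seq level :=
  sort (relpre (fun u => val u.1) leq)
    (enum [set u : level | (0 < u.1) && (u.2 \in block_patterns n.+1 (lam u.1))]).

Lemma mem_levels (u : level) :
  (u \in levels) = (0 < u.1) && (u.2 \in block_patterns n.+1 (lam u.1)).
Proof. by rewrite mem_sort mem_enum inE. Qed.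

Definition orientation (u : level) (t : nat) : bool :=
  nth true (orientations (lam u.1) u.2) t.

(** The subtraction reverses the order strictly because [x u.2] is below [multiplicity u.2]. *)
Definition signed_coord (u : level) (t : nat) (x : address) : nat :=
  if orientation u t then (x u.2 : nat) else multiplicity u.2 - x u.2.

Definition vertex_key (x : address) (i : nat) : seqlexi nat :=
  lex_key (fun (u : level) => part_index (lam u.1)) signed_coord levels x i.

Definition first_difference (x y : address) (u : level) : Prop :=
  [/\ u \in levels, x u.2 != y u.2 & exists ps1 ps2, [/\ levels = ps1 ++ u :: ps2,
      {in ps1, forall q : level, x q.2 = y q.2}
    & {in ps1, forall q : level, q.1 <= u.1}]].

Lemma first_difference_sym (x y : address) (u : level) :
  first_difference x y u -> first_difference y x u.
Proof.
move=> [ul xy [ps1 [ps2 [E same le]]]]; split; rewrite 1?eq_sym //.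
by exists ps1, ps2; split=> // q /same.
Qed.

Lemma first_difference_exists (x y : address) : x != y -> exists u, first_difference x y u.
Proof.
move=> xy.
have [P xyP] : exists P, x P != y P.
  apply/existsP; rewrite -negb_forall; apply: contra xy => /forallP xy.
  by apply/eqP/ffunP => P; apply/eqP.
have Pin : P \in chain_patterns.
  apply: contraNT xyP => Pn; apply/eqP/val_inj => /=.
  have: forall z : address, z P = 0 :> nat.
    move=> z; apply/eqP; rewrite -leqn0 -ltnS (leq_trans (ltn_ord (z P))) //.
    by rewrite /multiplicity (negbTE Pn).
  by move=> z0; rewrite !z0.
have [s /andP[s1 sr] Ps] := chain_patternsP _ Pin.
have has_diff : has (fun u : level => x u.2 != y u.2) levels.
  by apply/hasP; exists (Ordinal (sr : s < n.+2), P); rewrite // mem_levels s1.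
have: sorted (relpre (fun u : level => val u.1) leq) levels.
  by apply: sort_sorted => u v; apply: leq_total.
have [ps1 [u [ps2 [E uxy same]]]] := has_split has_diff.
rewrite E sorted_pairwise => [|? ? ?]; last exact: leq_trans.
rewrite pairwise_cat => /and3P[/allrelP le _ _].
exists u; split; rewrite // E; first by rewrite mem_cat mem_head orbT.
exists ps1, ps2; split=> // q qin; last by apply: le => //; rewrite mem_head.
by apply/eqP; move/hasPn: same => /(_ q qin)/negPn.
Qed.

(** The address with the smaller coordinate takes the label [true], that is A; in a block opened by
    B the reversed coordinate puts [y] first. *)
Lemma vertex_key_lt (x y : address) (u : level) :
  first_difference x y u -> x u.2 < y u.2 -> forall a b : bool * nat,
  before (lam u.1) (orientations (lam u.1) u.2) a b ->
  (vertex_key (if a.1 then x else y) a.2 < vertex_key (if b.1 then x else y) b.2)%O.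
Proof.
move=> [_ _ [ps1 [ps2 [E same le]]]] xy [p i] [q j].
rewrite /before /=; case: eqP => [<- ij|/eqP pq lt].
  by apply: lex_key_lt_index => // v; apply: leq_part_index.
rewrite /vertex_key E; apply: lex_key_lt => [v vin|v vin t|].
(* Earlier levels are no finer than [u.1], so their block indices are monotone in that of [u]. *)
- have vl : v \in levels by rewrite E mem_cat vin.
  apply: (chain_coarser chain); last by rewrite -ltnS ltn_ord.
    by move: vl; rewrite mem_levels => /andP[].
  exact: le.
- by rewrite /signed_coord; case: (p) (q) => [] []; rewrite // same.
- case/orP: lt => [->//|/andP[-> po]]; rewrite orbC /=.
  rewrite /signed_coord /orientation -(eqP po).
  case: (p) (q) pq => [] [] //= _; rewrite ?xy //.
  by rewrite ltn_sub2l // (leq_trans _ (ltn_ord (y u.2))).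
Qed.

(** * Edges, the patterns they form, and cliques *)

Let W : finType := (address * 'I_n.+1)%type.

Variable v : W -> 'I_#|W|.
Hypothesis v_key : {homo v : a b / (vertex_key a.1 a.2 < vertex_key b.1 b.2)%O >-> (a < b)%O}.

Definition edge_of (x : address) : {set 'I_#|W|} := [set v (x, i) | i : 'I_n.+1].

(** Distinct vertices have strictly comparable keys: by position within an edge, and otherwise by
    [before] at the first difference. *)
Lemma v_inj : injective v.
Proof.
move=> [x i] [y j] E; apply/eqP/negPn/negP => ne.
have not_key_lt (a b : W) : v a = v b -> ~ (vertex_key a.1 a.2 < vertex_key b.1 b.2)%O.
  by move=> ab /v_key; rewrite ab ltxx.
have part u : {homo part_index (lam u) : i j / i <= j} by apply: leq_part_index.
case: (eqVneq x y) ne E => [->|xy _ E].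
  rewrite xpair_eqE eqxx /= neq_ltn => /orP[] lt E.
    by apply: (not_key_lt _ _ E); apply: lex_key_lt_index.
  by apply: (not_key_lt _ _ (esym E)); apply: lex_key_lt_index.
have [u xyu] := first_difference_exists xy.
(* Label A belongs to the smaller coordinate, so [x] and [y] may be exchanged. *)
wlog lt : x y i j E xy xyu / x u.2 < y u.2.
  move=> wl; case: (ltngtP (x u.2) (y u.2)) => lt; first exact: (wl x y i j).
    by apply: (wl y x j i); rewrite 1?eq_sym //; apply: first_difference_sym.
  by case: xyu => _ /eqP + _; apply; apply: val_inj.
have key := vertex_key_lt xyu lt.
have := @before_total (lam u.1) (orientations (lam u.1) u.2) (true, val i) (false, val j) isT.
by case/orP => /key /=; [apply: not_key_lt E|apply: not_key_lt (esym E)].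
Qed.

Lemma v_onto (a : 'I_#|W|) : exists w, a = v w.
Proof.
have [g _ vK] := inj_card_bij v_inj (eq_leq (card_ord _)).
by exists (g a); rewrite vK.
Qed.

(** The inequality of the coordinates at the pattern formed is recorded for the clique bound. *)
Lemma edges_form (x y : address) : x != y ->
  exists2 P, P \in chain_patterns & forms (edge_of x) (edge_of y) P /\ x P != y P.
Proof.
move=> xy; have [u xyu] := first_difference_exists xy.
case: (xyu) => ul neq _; move: (ul); rewrite mem_levels => /andP[u1 uP].
have ur : u.1 <= n.+1 by rewrite -ltnS ltn_ord.
exists u.2; first by apply/chain_patternsP; exists u.1; rewrite ?u1.
split=> //; rewrite /forms -(block_word_orientations uP).
have lamP : ordered_partition n.+1 (lam u.1) by apply: chain.1; rewrite u1.
have /andP[/eqP lam_sum lam_pos] := lamP.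
have hd := head_orientations uP lamP.
have words (z t : address) : first_difference z t u -> z u.2 < t u.2 ->
    pair_word (edge_of z) (edge_of t) = block_word (lam u.1) (orientations (lam u.1) u.2) /\
    pair_word (edge_of t) (edge_of z) = block_word (lam u.1) (orientations (lam u.1) u.2).
  (* [inord] extends the vertices of an edge to all natural positions; only positions up to [n] are
     compared. *)
  move=> ztu lt; pose c p i := v (if p then z else t, inord i).
  have c_before (a b : bool * nat) : a.2 <= n -> b.2 <= n ->
      before (lam u.1) (orientations (lam u.1) u.2) a b -> (c a.1 a.2 < c b.1 b.2)%O.
    move=> an bn /(vertex_key_lt ztu lt) ab; apply: v_key => /=.
    by rewrite !inordK.
  have := pair_word_edges lam_sum lam_pos hd c_before.
  have cE p : [set c p i | i : 'I_n.+1] = edge_of (if p then z else t).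
    by apply: eq_imset => i; rewrite /c inord_val.
  by rewrite !cE.
case: (ltngtP (x u.2) (y u.2)) => lt; first by case: (words x y xyu lt).
  by case: (words y x (first_difference_sym xyu) lt).
by rewrite (val_inj lt) eqxx in neq.
Qed.

Lemma edge_of_inj : injective edge_of.
Proof.
move=> x y xy; have : v (x, ord0) \in edge_of y by rewrite -xy imset_f.
by case/imsetP => i _ /v_inj [].
Qed.

Lemma edges_matching : ordered_matching n.+1 [set edge_of x | x : address].
Proof.
split.
- apply/trivIsetP => _ _ /imsetP[x _ ->] /imsetP[y _ ->] xy.
  rewrite -setI_eq0; apply/eqP/setP => a; rewrite !inE; apply/andP => -[].
  move=> /imsetP[i _ ->] /imsetP[j _ /v_inj[E _]].
  by rewrite E eqxx in xy.
- move=> _ /imsetP[x _ ->]; rewrite card_imset ?card_ord // => i j /v_inj.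
  by case.
- apply/setP => a; rewrite inE; have [[x i] ->] := v_onto a.
  by apply/bigcupP; exists (edge_of x); rewrite imset_f.
Qed.

(** Two edges form only one pattern, so members of a [P]-clique differ in the coordinate at [P],
    which takes [m P] values. *)
Lemma edges_clique (P : word) (K : {set {set 'I_#|W|}}) : P \in chain_patterns ->
  K \subset [set edge_of x | x : address] -> is_clique P K -> #|K| <= m P.
Proof.
move=> PP KH KP; pose X := edge_of @^-1: K.
have -> : K = edge_of @: X.
  apply/setP => e; apply/idP/imsetP => [eK|[x + ->]]; last by rewrite inE.
  by have /imsetP[x _ E] := subsetP KH e eK; exists x; rewrite ?inE -?E.
rewrite card_imset; last exact: edge_of_inj.
have inj : {in X &, injective (fun x : address => x P)}.
  move=> x y; rewrite !inE => xK yK; apply: contra_eq => xy.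
  have [Q _ [Qxy xyQ]] := edges_form xy.
  have : edge_of x != edge_of y by rewrite (inj_eq edge_of_inj).
  by move=> /(KP _ _ xK yK); rewrite /forms Qxy => /val_inj <-.
rewrite -(card_in_imset inj) (leq_trans (max_card _)) // card_ord.
by rewrite /multiplicity PP.
Qed.

End Construction.

Theorem theorem4p1 (r : nat) (lam : nat -> seq nat)
    (m : (2 * r).-tuple letter -> nat) :
  let patterns := \bigcup_(1 <= s < r.+1) block_patterns r (lam s) in
  0 < r ->
  partition_chain r lam ->
  (forall P, P \in patterns -> 0 < m P) ->
  exists (d : Order.disp_t) (V : finOrderType d) (H : {set {set V}}),
    [/\ ordered_matching r H,
        #|H| = \prod_(P in patterns) m P,
        forall e f, e \in H -> f \in H -> e != f ->
          exists2 P, P \in patterns & forms e f P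
      & forall (P : (2 * r).-tuple letter) (K : {set {set V}}),
          P \in patterns -> K \subset H -> is_clique P K -> #|K| <= m P].
Proof.
case: r m => // n m patterns _ chain _.
pose W : finType := (address lam m * 'I_n.+1)%type.
pose lt := [rel a b : W | (vertex_key a.1 a.2 < vertex_key b.1 b.2)%O].
have lt_irr : irreflexive lt by move=> a; apply: ltxx.
have lt_tr : transitive lt by move=> b a c; apply: lt_trans.
(* Ranking by key orders the vertices. The ranks exhaust the ordinal, as [ordered_matching] asks of
   the vertex type. *)
have [v v_key] := rank_ordinal lt_irr lt_tr.
exists _, ('I_#|W| : finOrderType _), [set edge_of v x | x : address lam m]; split.
- exact: edges_matching.
- by rewrite card_imset ?card_address //; apply: edge_of_inj.
- move=> _ _ /imsetP[x _ ->] /imsetP[y _ ->] ne.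
  have xy : x != y by apply: contraNneq ne => ->.
  by have [P PP [xyP _]] := edges_form chain v_key xy; exists P.
- by move=> P K; apply: edges_clique.
Qed.
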